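(* Let $p,q\ge2$ and let $(x_n,x_n')$ be a sequence in the Diestel--Leader graph $\mathrm{DL}(p,q)$. In the horocompactification of $\mathrm{DL}(p,q)$: - $(x_n,x'_n)\to\rho_\omega$ if $x_n\to\omega\ne\omega_0$, where $\omega\in\partial T$ (and hence $x_n'\to\omega_0'$); - $(x_n,x'_n)\to\rho'_{\omega'}$ if $x'_n\to\omega'\ne\omega'_0$, where $\omega'\in\partial T'$ (and hence $x_n\to\omega_0$); - $(x_n,x'_n)\to\rho_{\omega_0}$ if $x_n\to\omega_0$, $x_n'\to\omega_0'$ and $h(x_n)\to+\infty$; - $(x_n,x'_n)\to\rho'_{\omega'_0}$ if $x_n\to\omega_0$, $x_n'\to\omega_0'$ and $h'(x'_n)\to+\infty$; - $(x_n,x'_n)\to\rho_{x_0}$ if $x_n=x_0$ for all $n$ and $d(x_n',o')\to\infty$ (with $h'(x_n')=-h(x_0)$); - $(x_n,x'_n)\to\rho'_{x'_0}$ if $x'_n=x'_0$ for all $n$ and $d(x_n,o)\to\infty$ (with $h(x_n)=-h'(x'_0)$); - $(x_n,x'_n)\to\rho_i$ if $d(x_n,o)\to\infty$ and $d(x_n',o')\to\infty$ with $h(x_n)=-h'(x_n')=i$ for all $n$.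
   Context: $T,T'$ are the $(p+1)$-regular and $(q+1)$-regular trees with fixed vertices $o,o'$ and fixed ends $\omega_0\in\partial T$, $\omega_0'\in\partial T'$; convergence of vertices to ends is in the end compactification. For $u,v\in T$, $u\wedge v$ is the common vertex of the geodesics $uv$, $u\omega_0$, $v\omega_0$, and $h(u)=d(u,u\wedge o)-d(o,u\wedge o)$; $\wedge$ and $h'$ on $T'$ are defined similarly. $\mathrm{DL}(p,q)$ has vertex set $\{(v,v')\in T\times T':h(v)+h'(v')=0\}$, with $(v,v')\sim(w,w')$ iff $v\sim w$ and $v'\sim w'$, and the graph distance $d$. Functions on $\mathrm{DL}(p,q)$ (considered modulo additive constants): $\rho_\omega(y,y')=\lim_{x\to\omega}(d(y,x)-d(o,x))$ for $\omega\in\partial T$; $\rho'_{\omega'}(y,y')=\lim_{x'\to\omega'}(d(y',x')-d(o',x'))$ for $\omega'\in\partial T'$; $\rho_{x_0}(y,y')=-2h(y\wedge x_0)-|h(y)-h(x_0)|$ for $x_0\in T$; $\rho'_{x'_0}(y,y')=-2h'(y'\wedge x'_0)-|h'(y')-h'(x_0')|$ for $x'_0\in T'$; $\rho_i(y,y')=-|h(y)-i|$ for $i\in\mathbb Z$. A sequence $z_n$ in $\mathrm{DL}(p,q)$ converges to (the class of) $f$ in the horocompactification if $d(z_n,\cdot)-d(z_n,(o,o'))\to f-f(o,o')$ pointwise. *)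

(* Defs.v *)
From mathcomp Require Import all_boot all_order all_algebra.
From mathcomp Require Import all_classical all_reals all_analysis.
Import Order.TTheory GRing.Theory Num.Theory.
Import numFieldNormedType.Exports.

Set Implicit Arguments.
Unset Strict Implicit.
Unset Printing Implicit Defensive.

Local Open Scope classical_set_scope.
Local Open Scope ring_scope.

Section Graph.
Context {V : choiceType} (e : rel V).

Definition walk_length (u v : V) (n : nat) : Prop :=
  exists s : seq V, [/\ path e u s, last u s = v & size s = n].

(* Junk value 0 when u and v are not connected. *)
Definition gdist (u v : V) : nat :=
  match pselect (exists n, `[< walk_length u v n >]) with
  | left ex => ex_minn ex
  | right _ => 0%N
  end.

(* [ucycle] allows the degenerate back-and-forth cycles [:: x; y], which are
   not cycles of the graph. *)
Definition is_tree : Prop :=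
  [/\ symmetric e, irreflexive e,
      forall u v, exists s, path e u s /\ last u s = v
    & forall c : seq V, ucycle e c -> (size c <= 2)%N].

Definition regular (k : nat) : Prop := forall v, ([set w | e v w] #= `I_k)%card.

Definition regular_tree (k : nat) : Prop := is_tree /\ regular k.

Definition geodesic (u v : V) : set V :=
  [set w | exists s, [/\ path e u s, last u s = v, size s = gdist u v
                       & w \in u :: s]].

Definition is_ray (r : nat -> V) : Prop :=
  (forall n, e (r n) (r n.+1)) /\ injective r.

Definition same_tail (r s : nat -> V) : Prop :=
  exists m n, forall k, r (m + k)%N = s (n + k)%N.

(* An end of a tree is an equivalence class of rays. *)
Record tree_end := TreeEnd {
  end_rays : set (nat -> V);
  end_raysP : exists2 r, is_ray r &
    end_rays = [set s | is_ray s /\ same_tail r s] }.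

Definition geodesic_to_end (u : V) (w : tree_end) : set V :=
  [set v | exists2 r, end_rays w r & r 0%N = u /\ exists n, r n = v].

(* The component of the complement of F in which w lives: the vertices joined
   by a path avoiding F to a tail, avoiding F, of a ray of w. *)
Definition end_component (F : set V) (w : tree_end) : set V :=
  [set x | exists2 r, end_rays w r & exists m s,
    [/\ forall n, (m <= n)%N -> ~ F (r n), path e x s, last x s = r m
      & forall y, y \in x :: s -> ~ F y]].

(* The trace on the vertices of the neighbourhood filter of w in the end
   compactification. *)
Definition end_nbhs (w : tree_end) : set_system V :=
  [set A | exists2 F, finite_set F & end_component F w `<=` A].

End Graph.

Section Tree.
Context {V : choiceType} {e : rel V}.

Definition confluent (w0 : tree_end e) (u v : V) : V :=
  xget u (geodesic e u v `&` geodesic_to_end u w0 `&` geodesic_to_end v w0).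

Definition height (w0 : tree_end e) (o u : V) : int :=
  (gdist e u (confluent w0 u o))%:Z - (gdist e o (confluent w0 u o))%:Z.

Context (R : realType).

Definition busemann (o : V) (w : tree_end e) (y : V) : R :=
  lim (((gdist e y x)%:R - (gdist e o x)%:R : R) @[x --> end_nbhs w]).

Definition vertex_fun (w0 : tree_end e) (o x0 y : V) : R :=
  (- 2 * height w0 o (confluent w0 y x0)
   - `|height w0 o y - height w0 o x0|)%:~R.

Definition level_fun (w0 : tree_end e) (o : V) (i : int) (y : V) : R :=
  (- `|height w0 o y - i|)%:~R.

End Tree.

Section DiestelLeader.
Context {T T' : choiceType} {e : rel T} {e' : rel T'}.
Variables (w0 : tree_end e) (o : T) (w0' : tree_end e') (o' : T').

Definition DL_vertex : Type :=
  {x : T * T' | height w0 o x.1 + height w0' o' x.2 == 0}.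

Definition DL_fst (x : DL_vertex) : T := (sval x).1.
Definition DL_snd (x : DL_vertex) : T' := (sval x).2.

Definition DL_adj : rel DL_vertex :=
  fun x y => e (DL_fst x) (DL_fst y) && e' (DL_snd x) (DL_snd y).

Lemma DL_base_proof : height w0 o o + height w0' o' o' == 0.
Proof. by rewrite /height !subrr. Qed.

Definition DL_base : DL_vertex := exist _ (o, o') DL_base_proof.

Context (R : realType).

Definition horo_cvg (z : nat -> DL_vertex) (f : DL_vertex -> R) : Prop :=
  forall y, ((gdist DL_adj (z n) y)%:R - (gdist DL_adj (z n) DL_base)%:R : R)
    @[n --> \oo] --> f y - f DL_base.

Definition rho_end (w : tree_end e) (y : DL_vertex) : R :=
  busemann R o w (DL_fst y).
Definition rho_end' (w' : tree_end e') (y : DL_vertex) : R :=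
  busemann R o' w' (DL_snd y).
Definition rho_vertex (x0 : T) (y : DL_vertex) : R :=
  vertex_fun R w0 o x0 (DL_fst y).
Definition rho_vertex' (x0' : T') (y : DL_vertex) : R :=
  vertex_fun R w0' o' x0' (DL_snd y).
Definition rho_level (i : int) (y : DL_vertex) : R :=
  level_fun R w0 o i (DL_fst y).

End DiestelLeader.

(* Main.v *)
(* An end of a tree gives every vertex a parent, the next vertex towards the
   end.  Everything in a tree is read off the iterates of the parent map: the
   geodesic from u to v climbs m steps and then descends n steps, where (m, n)
   is least with parent^m u = parent^n v, and the height drops by one at every
   step towards the end.  In DL(p,q) this yields
     d((x,x'),(y,y')) = d(x,y) + d(x',y') - |h(x) - h(y)|:
   along an edge the right-hand side changes by at most one, and a path of this
   length climbs in one tree exactly while it descends in the other.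
   If x leaves the set of descendants of a common ancestor of y and o (with
   respect to an end w), then d(x,y) - d(x,o) is the height of y with respect
   to w.  Applied to w this computes the Busemann function, and in each case of
   the theorem it makes the differences of distances eventually constant. *)
Require Import Defs.
From mathcomp Require Import all_boot all_order all_algebra.
From mathcomp Require Import all_classical all_reals all_analysis.
From mathcomp Require Import zify.
Import Order.TTheory GRing.Theory Num.Theory.
Import numFieldNormedType.Exports.
Local Open Scope classical_set_scope.
Local Open Scope ring_scope.

(** * Walks and the graph distance *)

Section Walks.
Context {V : choiceType} {e : rel V}.

Lemma walk_step (u v w : V) (n : nat) :
  e u v -> walk_length e v w n -> walk_length e u w n.+1.
Proof.
move=> uv [s [sp sl sn]]; exists (v :: s); split=> //=; last by rewrite sn.
by rewrite uv.
Qed.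

Lemma walk_inv (u w : V) (n : nat) :
  walk_length e u w n.+1 -> exists2 v, e u v & walk_length e v w n.
Proof.
move=> [[|v s] []] //= /andP[uv sp] sl [sn].
by exists v => //; exists s.
Qed.

Lemma walk0 (u v : V) : walk_length e u v 0 <-> u = v.
Proof.
split=> [[s [_ <- /size0nil->]]//|->].
by exists [::].
Qed.

Lemma walk_cat (u v w : V) (m n : nat) :
  walk_length e u v m -> walk_length e v w n -> walk_length e u w (m + n).
Proof.
move=> [s [sp sl <-]] [t [tp tl <-]]; exists (s ++ t).
by rewrite cat_path sp sl tp last_cat sl tl size_cat.
Qed.

Lemma walk_sym (u v : V) (n : nat) :
  symmetric e -> walk_length e u v n -> walk_length e v u n.
Proof.
move=> esym; elim: n u => [u /walk0->|n IH u /walk_inv[x ux /IH xv]].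
  exact/walk0.
rewrite -addn1; apply: (walk_cat _ x) => //.
by apply: (walk_step _ u); [rewrite esym|exact/walk0].
Qed.

Lemma gdist_le (u v : V) (n : nat) :
  walk_length e u v n -> (gdist e u v <= n)%N.
Proof.
rewrite /gdist; case: pselect => // ex uv.
by case: ex_minnP => m _; apply; exact/asboolP.
Qed.

Lemma gdist_walk (u v : V) (n : nat) :
  walk_length e u v n -> walk_length e u v (gdist e u v).
Proof.
rewrite /gdist; case: pselect => [ex|nex] uv; last first.
  by case: nex; exists n; exact/asboolP.
by case: ex_minnP => m /asboolP.
Qed.

Lemma gdist_eq (u v : V) (n : nat) : walk_length e u v n ->
  (forall m, walk_length e u v m -> (n <= m)%N) -> gdist e u v = n.
Proof.
move=> uv mn; apply/eqP; rewrite eqn_leq gdist_le//=.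
by apply: mn; apply: gdist_walk uv.
Qed.

End Walks.

(** * Rays and ends of a tree *)

Section Rays.
Context {V : choiceType} {e : rel V}.

Lemma same_tail_sym (r s : nat -> V) : same_tail r s -> same_tail s r.
Proof. by move=> [m [n h]]; exists n, m. Qed.

Lemma same_tail_trans (r s t : nat -> V) :
  same_tail r s -> same_tail s t -> same_tail r t.
Proof.
move=> [m [n rs]] [a [b st]]; exists (m + a)%N, (b + n)%N => k.
by rewrite -addnA rs addnCA st addnA.
Qed.

(** Having a common tail is an equivalence relation, so any ray of the end can replace the
    representative chosen in the record. *)
Lemma end_raysE (w : tree_end e) (r : nat -> V) : end_rays w r ->
  end_rays w = [set s | is_ray e s /\ same_tail r s].
Proof.
have [r0 ray0 ->] := end_raysP w => -[rayr r0r].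
apply/seteqP; split=> s /= [rays st]; split => //.
  exact: same_tail_trans (same_tail_sym _ _ r0r) st.
exact: same_tail_trans r0r st.
Qed.

Lemma end_rays_ray {w : tree_end e} {r} : end_rays w r -> is_ray e r.
Proof. by have [r0 _ ->] := end_raysP w => -[]. Qed.

Lemma end_eq (w1 w2 : tree_end e) (r : nat -> V) :
  end_rays w1 r -> end_rays w2 r -> w1 = w2.
Proof.
move=> /end_raysE E1 /end_raysE E2.
have: end_rays w1 = end_rays w2 by rewrite E1 E2.
case: w1 w2 {E1 E2} => [R1 p1] [R2 p2] /= R12.
by subst R2; congr TreeEnd; exact: Prop_irrelevance.
Qed.

Lemma ray_shift (r : nat -> V) (i : nat) :
  is_ray e r -> is_ray e (fun n => r (i + n)%N).
Proof.
move=> [re ri]; split=> [n|m n /ri/addnI//].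
by rewrite addnS.
Qed.

Lemma end_ray_shift (w : tree_end e) (r : nat -> V) (i : nat) :
  end_rays w r -> end_rays w (fun n => r (i + n)%N).
Proof.
move=> wr; rewrite (end_raysE _ _ wr); split.
  by apply: ray_shift; exact: end_rays_ray wr.
by exists i, 0%N.
Qed.

Definition ray_cons (u : V) (r : nat -> V) (n : nat) : V :=
  if n is m.+1 then r m else u.

Lemma ray_consP (u : V) (r : nat -> V) :
  is_ray e r -> e u (r 0%N) -> (forall n, r n <> u) -> is_ray e (ray_cons u r).
Proof.
move=> [re ri] ur nu; split=> [[|n]//=|[|m] [|n]//=].
- by move=> /esym/nu.
- by move=> /nu.
- by move=> /ri->.
Qed.

Lemma path_ray (r : nat -> V) (a n : nat) : is_ray e r ->
  path e (r a) [seq r k | k <- iota a.+1 n].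
Proof.
by move=> [re _]; elim: n a => //= n IH a; rewrite re IH.
Qed.

Lemma last_ray (r : nat -> V) (a n : nat) :
  last (r a) [seq r k | k <- iota a.+1 n] = r (a + n)%N.
Proof. by elim: n a => /= [a|n IH a]; rewrite ?addn0 // IH addSnnS. Qed.

Context (treeP : is_tree e).

(** A chord to [r i] with [i >= 2] would close a cycle of at least three vertices, and [i = 0] would
    give a loop. *)
Lemma ray_no_chord (r : nat -> V) (i : nat) :
  is_ray e r -> e (r 0%N) (r i) -> i = 1%N.
Proof.
move=> rayr; have [esym eirr _ acyc] := treeP.
case: i => [|i]; first by rewrite eirr.
move=> ri; have /acyc : ucycle e (map r (iota 0 i.+2)).
  apply/andP; split.
    have -> : cycle e (map r (iota 0 i.+2)) =
        path e (r 0%N) (rcons [seq r k | k <- iota 1 i.+1] (r 0%N)) by [].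
    by rewrite rcons_path path_ray //= -/(iota 1 i.+1) last_ray esym.
  by rewrite map_inj_uniq ?iota_uniq //; case: rayr.
by rewrite size_map size_iota; case: i {ri}.
Qed.

Lemma ray_from_uniq (s t : nat -> V) : is_ray e s -> is_ray e t ->
  s 0%N = t 0%N -> same_tail s t -> s 1%N = t 1%N.
Proof.
move=> rays rayt st0 [m [n st]]; apply: contrapT => st1.
have [esym _ _ _] := treeP; have [te ti] := rayt.
(* Running back along [t] from [t j] to the common origin and then along [s]
   is again a ray, as long as [s] and [t] diverge at once. *)
have key j : exists R, [/\ is_ray e R, R 0%N = t j,
    forall k, R (j + k)%N = s k & ((0 < j)%N -> R 1%N = t j.-1)].
  elim: j => [|j [R [rayR R0 Rs R1]]]; first by exists s.
  exists (ray_cons (t j.+1) R); split => //.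
  apply: ray_consP => //; first by rewrite R0 esym.
  (* Without chords the new vertex could only be [R 1], which is [s 1] if [j = 0] and [t (j - 1)]
     otherwise; both differ from [t (j + 1)]. *)
  move=> i Ri; have /ray_no_chord i1 : e (R 0%N) (R i) by rewrite R0 Ri.
  move: Ri; rewrite i1 //.
  case: j R0 Rs R1 => [|j] R0 Rs R1.
    by rewrite -[1%N]add0n Rs => /st1.
  by rewrite R1 //= => /ti; lia.
(* [s (m + 1) = t (n + 1)] makes [R] return to its start; the added 1 keeps the return time positive
   when [m = n = 0]. *)
have [R [[_ Ri] R0 Rs _]] := key (n + 1)%N.
have : R 0%N = R (n + 1 + (m + 1))%N by rewrite R0 Rs st.
by move=> /Ri; lia.
Qed.

(** Follow a path from the start of some ray to [u]: a new vertex on the current ray cuts off an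
    initial segment, any other is prepended. *)
Lemma ray_from (w : tree_end e) (u : V) : exists2 r, end_rays w r & r 0%N = u.
Proof.
have [esym _ conn _] := treeP.
have [r0 ray0 wE] := end_raysP w.
have w0 : end_rays w r0 by rewrite wE; split => //; exists 0%N, 0%N.
have [s [sp <-]] := conn (r0 0%N) u.
have : exists2 r, end_rays w r & r 0%N = r0 0%N by exists r0.
elim: s (r0 0%N) sp => //= v s IH x /andP[xv sp] [r wr rx].
apply: IH => //; have [[i ri]|nr] := pselect (exists i, r i = v).
  by exists (fun n => r (i + n)%N); [exact: end_ray_shift|rewrite addn0].
exists (ray_cons v r) => //; rewrite (end_raysE _ _ wr); split; last first.
  by exists 0%N, 1%N.
apply: ray_consP; [exact: end_rays_ray wr|by rewrite rx esym|].
by move=> n rn; apply: nr; exists n.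
Qed.

End Rays.

(** * The parent map of an end, distances and heights *)

Section Parent.
Context {V : choiceType} {e : rel V} (w : tree_end e).

(** In a tree [ray_from] and [ray_from_uniq] give exactly one such second vertex, so [xget] never
    falls back on [u]. *)
Definition parent (u : V) : V :=
  xget u [set v | exists2 r, end_rays w r & r 0%N = u /\ r 1%N = v].

Context (treeP : is_tree e).

Lemma ray_parent (r : nat -> V) : end_rays w r -> r 1%N = parent (r 0%N).
Proof.
move=> wr; rewrite /parent; case: xgetP => [v _ [s ws [s0 <-]]|/(_ (r 1%N)) []].
  apply: (ray_from_uniq treeP _ _ (end_rays_ray wr) (end_rays_ray ws)) => //.
  by move: ws; rewrite (end_raysE _ _ wr) => -[].
by exists r.
Qed.

Lemma ray_iter (r : nat -> V) (n : nat) :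
  end_rays w r -> r n = iter n parent (r 0%N).
Proof.
move=> wr; elim: n => //= n <-.
have := ray_parent _ (end_ray_shift _ _ n wr).
by rewrite addn1 addn0.
Qed.

Lemma iter_ray (u : V) : end_rays w (fun n => iter n parent u).
Proof.
have [r wr r0] := ray_from treeP w u.
rewrite (_ : (fun n => _) = r) //.
by apply/funext => n; rewrite (ray_iter _ _ wr) r0.
Qed.

(** If [v] lies on the ray from [u], it is the next vertex, as rays have no chords; otherwise
    prepending [v] to that ray gives the ray from [v]. *)
Lemma edge_parent (u v : V) : e u v <-> v = parent u \/ u = parent v.
Proof.
have [esym _ _ _] := treeP.
have par x : e x (parent x) := (end_rays_ray (iter_ray x)).1 0%N.
split=> [uv|[->//|->]]; last by rewrite esym.
have [[i iv]|nv] := pselect (exists i, iter i parent u = v).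
  left; rewrite -iv (_ : i = 1%N) //.
  apply: (ray_no_chord treeP _ _ (end_rays_ray (iter_ray u))) => /=.
  by rewrite iv.
right; have := ray_parent (ray_cons v (fun n => iter n parent u)); apply.
rewrite (end_raysE _ _ (iter_ray u)); split; last by exists 0%N, 1%N.
apply: ray_consP; [exact: end_rays_ray (iter_ray u)|by rewrite /= esym|].
by move=> n un; apply: nv; exists n.
Qed.

Lemma iter_parent_inj (u : V) (m n : nat) :
  iter m parent u = iter n parent u -> m = n.
Proof. exact: (end_rays_ray (iter_ray u)).2. Qed.

(* The geodesics from [u] and [v] to the end merge after exactly [m] and [n]
   steps. *)
Definition meet (u v : V) (m n : nat) : Prop :=
  iter m parent u = iter n parent v /\
  forall a b, iter a parent u = iter b parent v -> (m <= a)%N /\ (n <= b)%N.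

Lemma meet_sym (u v : V) (m n : nat) : meet u v m n -> meet v u n m.
Proof.
move=> [uv mn]; split=> [|a b ab]; first by rewrite uv.
by have [] := mn b a (esym ab).
Qed.

Lemma iter_parent_diff (u v : V) (m n a b : nat) :
  iter m parent u = iter n parent v -> iter a parent u = iter b parent v ->
  (m + b = n + a)%N.
Proof.
move=> mn ab; apply: (iter_parent_inj u).
by rewrite addnC iterD mn -iterD addnC iterD -ab -iterD.
Qed.

(** The number of steps from [u] is minimized; since [iter_parent_diff] fixes the difference, the
    number of steps from [v] is then least too. *)
Lemma meet_ex (u v : V) : exists m n, meet u v m n.
Proof.
have ex : exists m, `[< exists n, iter m parent u = iter n parent v >].
  have := iter_ray v; rewrite (end_raysE _ _ (iter_ray u)) => -[_ [m [n mn]]].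
  exists m; apply/asboolP; exists n.
  by have := mn 0%N; rewrite !addn0.
case: (ex_minnP ex) => m /asboolP[n mn] min; exists m, n; split => // a b ab.
have ma : (m <= a)%N by apply: min; apply/asboolP; exists b.
by have := iter_parent_diff _ _ _ _ _ _ mn ab; lia.
Qed.

Lemma walk_up (u : V) (m : nat) : walk_length e u (iter m parent u) m.
Proof.
elim: m u => [|m IH] u; first exact/walk0.
by rewrite iterSr; apply: walk_step (IH _); apply/edge_parent; left.
Qed.

Lemma walk_join (u v : V) (m n : nat) :
  iter m parent u = iter n parent v -> walk_length e u v (m + n).
Proof.
have [esym _ _ _] := treeP.
move=> mn; apply: walk_cat (walk_up u m) _.
by rewrite mn; apply: walk_sym => //; exact: walk_up.
Qed.

(** For the lower bound, the first edge of a walk leads to the parent or to a child of [u], and in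
    both cases [m + n] drops by at most one. *)
Lemma gdist_meet (u v : V) (m n : nat) :
  meet u v m n -> gdist e u v = (m + n)%N.
Proof.
move=> [mn min]; apply: gdist_eq => [|k]; first exact: walk_join.
elim: k u m n mn min => [|k IH] u m n mn min.
  by move=> /walk0 uv; have := min 0%N 0%N; rewrite uv => /(_ erefl); lia.
move=> /walk_inv[x ux xv]; have [a [b [ab mab]]] := meet_ex x v.
have := IH _ _ _ ab mab xv.
move/edge_parent: ux => [xu|ux].
  by have := min a.+1 b; rewrite iterSr -xu => /(_ ab); lia.
case: a ab {mab} => [|a] ab.
  by have := min 0%N b.+1; rewrite /= -ab => /(_ ux); lia.
by have := min a b; rewrite ux -iterSr => /(_ ab); lia.
Qed.

Lemma gdist_sym (u v : V) : gdist e u v = gdist e v u.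
Proof.
have [m [n mn]] := meet_ex u v.
rewrite (gdist_meet _ _ _ _ mn) addnC.
by rewrite (gdist_meet _ _ _ _ (meet_sym _ _ _ _ mn)).
Qed.

Lemma gdist_iter (u : V) (m : nat) : gdist e u (iter m parent u) = m.
Proof.
rewrite (gdist_meet _ _ m 0%N) ?addn0 //; split=> // a b.
by rewrite -iterD => /iter_parent_inj; lia.
Qed.

Lemma geodesic_to_endE (u : V) :
  geodesic_to_end u w = range (fun n => iter n parent u).
Proof.
apply/seteqP; split=> v /=.
  move=> [r wr [<- [n <-]]]; exists n => //; exact/esym/ray_iter.
move=> [n _ <-]; exists (fun k => iter k parent u); first exact: iter_ray.
by split; last exists n.
Qed.

Lemma geodesic_cat (u v x : V) (m n : nat) :
  walk_length e u x m -> walk_length e x v n ->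
  (m + n)%N = gdist e u v -> geodesic e u v x.
Proof.
move=> [s [sp sl sm]] [t [tp tl tn]] d; exists (s ++ t).
rewrite cat_path sp sl tp last_cat sl tl size_cat sm tn d; split => //.
by rewrite -cat_cons mem_cat -sl mem_last.
Qed.

Lemma geodesic_walk (u v x : V) : geodesic e u v x -> exists m n,
  [/\ walk_length e u x m, walk_length e x v n & (m + n)%N = gdist e u v].
Proof.
move=> [s [sp sl sd]]; rewrite inE => /orP[/eqP->|].
  by exists 0%N, (gdist e u v); split => //; [exact/walk0|exists s].
move=> xs; case/path.splitP: xs sp sl sd => s1 s2.
rewrite cat_path last_rcons => /andP[p1 p2].
rewrite last_cat last_rcons size_cat => sl sd.
exists (size (rcons s1 x)), (size s2); split => //.
  by exists (rcons s1 x); rewrite last_rcons.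
by exists s2.
Qed.

(** A point of the geodesic lying [k] steps above [u] and [l] above [v] has [k + l <= m + n], while
    minimality gives [m <= k] and [n <= l]. The meeting point qualifies, so [xget] does not use its
    default. *)
Lemma confluent_meet (u v : V) (m n : nat) :
  meet u v m n -> confluent w u v = iter m parent u.
Proof.
move=> mn; have d := gdist_meet _ _ _ _ mn; case: (mn) => E min.
have [esym _ _ _] := treeP.
rewrite /confluent !geodesic_to_endE; case: xgetP => [x _ [[]]|].
  move=> /geodesic_walk [a [b [ux xv ab]]] [k _ ku] [l _ lv].
  have := min k l; rewrite ku lv => /(_ erefl).
  have := gdist_le _ _ _ ux; rewrite -ku gdist_iter.
  have := gdist_le _ _ _ xv; rewrite gdist_sym -lv gdist_iter => lb ka kl.
  by congr (iter _ _ _); lia.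
move=> /(_ (iter m parent u)) []; split; first split.
- apply: (geodesic_cat _ _ _ m n) => //; first exact: walk_up.
  by rewrite E; apply: walk_sym => //; exact: walk_up.
- by exists m.
- by exists n.
Qed.

Context (o : V).
Local Notation h := (height w o).

(** The difference of the step numbers is the same at every common ancestor, so any one of them
    computes the height. *)
Lemma heightE (u : V) (m n : nat) :
  iter m parent u = iter n parent o -> h u = m%:Z - n%:Z.
Proof.
move=> mn; have [a [b ab]] := meet_ex u o.
rewrite /height (confluent_meet _ _ _ _ ab) gdist_iter ab.1 gdist_iter.
by have := iter_parent_diff _ _ _ _ _ _ mn ab.1; lia.
Qed.

Lemma height_base : h o = 0.
Proof. by rewrite (heightE o 0%N 0%N). Qed.

Lemma height_iter (u : V) (m : nat) : h (iter m parent u) = h u - m%:Z.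
Proof.
have [a [b [ab _]]] := meet_ex u o.
rewrite (heightE _ a (m + b)%N); last by rewrite -iterD addnC !iterD ab.
by rewrite (heightE _ _ _ ab); lia.
Qed.

Lemma height_parent (u : V) : h (parent u) = h u - 1.
Proof. exact: (height_iter u 1). Qed.

Lemma height_join (u v : V) (m n : nat) :
  iter m parent u = iter n parent v -> h u - m%:Z = h v - n%:Z.
Proof. by move=> mn; rewrite -!height_iter mn. Qed.

(** The confluent has height [h u - m = h v - n], and the distance is [m + n]. This brings in the
    confluents of [vertex_fun]. *)
Lemma gdist_confluent (u v : V) :
  (gdist e u v)%:Z = h u + h v - 2 * h (confluent w u v).
Proof.
have [m [n mn]] := meet_ex u v.
rewrite (confluent_meet _ _ _ _ mn) (gdist_meet _ _ _ _ mn) height_iter.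
by have := height_join _ _ _ _ mn.1; lia.
Qed.

End Parent.

(** * Branches of descendants and neighbourhoods of ends *)

Section EndLimits.
Context {V : choiceType} {e : rel V} (treeP : is_tree e) (w : tree_end e).

Definition below (v x : V) : Prop := exists n, iter n (parent w) x = v.

(** A descendant other than [v] is at least one step below [v], so its parent and its children are
    still descendants. *)
Lemma below_edge (v x y : V) : e x y -> x <> v -> below v x -> below v y.
Proof.
move=> /(edge_parent w treeP) xy xv [[//|n] nx].
case: xy => [->|xy]; first by exists n; rewrite -iterSr.
by exists n.+2; rewrite iterSr -xy.
Qed.

Lemma below_path (v x : V) (s : seq V) : path e x s ->
  (forall y, y \in x :: s -> y <> v) -> below v x <-> below v (last x s).
Proof.
have [esym _ _ _] := treeP.
elim: s x => //= y s IH x /andP[xy sp] sv.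
have xv : x <> v by apply: sv; rewrite mem_head.
have yv : y <> v by apply: sv; rewrite !inE eqxx orbT.
rewrite -IH //; last by move=> z zs; apply: sv; rewrite in_cons zs orbT.
split; first exact: below_edge.
by apply: below_edge; rewrite // esym.
Qed.

(** A path avoiding [v] neither enters nor leaves the branch under [v], so [x] lies on the same side
    as the tail of any ray of [w1]. *)
Lemma component_below (w1 : tree_end e) (r : nat -> V) (v x : V) :
  end_rays w1 r -> end_component [set v] w1 x ->
  exists N, forall k, (N <= k)%N -> below v x <-> below v (r k).
Proof.
move=> w1r [r1 w1r1 [m [s [r1v sp sl sv]]]].
have [re _] := end_rays_ray w1r1.
move: w1r; rewrite (end_raysE _ _ w1r1) => -[_ [b [a ba]]].
have step k : below v x <-> below v (r1 (m + k)%N).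
  rewrite (below_path _ _ _ sp sv) sl.
  have -> : r1 (m + k)%N = last (r1 m) [seq r1 i | i <- iota m.+1 k].
    by rewrite last_ray.
  apply: below_path; first by apply: path_ray; exact: end_rays_ray w1r1.
  move=> y; rewrite -[_ :: _]/(map r1 (iota m k.+1)) => /mapP[i].
  by rewrite mem_iota => /andP[mi _] ->; exact: r1v.
(* [r] from [a] on is [r1] from [b] on; adding [m] takes the index in [r1] past the point where it
   starts avoiding [v]. *)
exists (a + m)%N => k amk; rewrite (step (b + (k - (a + m)))%N).
have -> : r1 (m + (b + (k - (a + m))))%N = r k; last by [].
by rewrite addnCA ba; congr r; lia.
Qed.

(** The ray of [w] from [v] climbs strictly above [v], so its tail is outside the branch. *)
Lemma component_not_below (v x : V) :
  end_component [set v] w x -> ~ below v x.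
Proof.
move=> /(component_below _ _ _ _ (iter_ray w treeP v))[N /(_ N.+1)].
move=> /(_ (leqnSn _)) -> [n]; rewrite -iterD => E.
by have := iter_parent_inj w treeP v _ 0%N E; lia.
Qed.

Lemma end_nbhs_not_below (v : V) :
  \forall x \near end_nbhs w, ~ below v x.
Proof.
by exists [set v]; [exact: finite_set1|exact: component_not_below].
Qed.

(** A ray that always moves to the parent belongs to [w]. After one step down it cannot turn up
    again without repeating a vertex. *)
Lemma ray_not_end (w1 : tree_end e) (r : nat -> V) : w1 <> w ->
  end_rays w1 r -> exists N, forall n, parent w (r (N + n.+1)%N) = r (N + n)%N.
Proof.
move=> w1w w1r; have [re ri] := end_rays_ray w1r.
have [N rN] : exists N, parent w (r N.+1) = r N.
  apply: contrapT => /forallNP noN; apply: w1w.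
  apply: (end_eq _ _ r) => //.
  rewrite (_ : r = fun n => iter n (parent w) (r 0%N)); first exact: iter_ray.
  apply/funext; elim=> //= n <-.
  have /(edge_parent w treeP) [->//|E] := re n.
  by case: (noN n).
exists N; elim=> [|n IH]; first by rewrite addn1 addn0.
have := re (N + n.+1)%N; rewrite -addnS => /(edge_parent w treeP)[|->//].
by rewrite IH => /ri; lia.
Qed.

(** A ray of [w1] finally descends with respect to [w], hence reaches a vertex of height at least
    [M]; removing that vertex leaves [w1] in a component made of its descendants. *)
Lemma end_nbhs_height (o : V) (w1 : tree_end e) (M : int) : w1 <> w ->
  \forall x \near end_nbhs w1, M <= height w o x.
Proof.
move=> w1w; have [r0 ray0 w1E] := end_raysP w1.
have w1r : end_rays w1 r0 by rewrite w1E; split => //; exists 0%N, 0%N.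
have [N rN] := ray_not_end _ _ w1w w1r.
have up n k : iter k (parent w) (r0 (N + (n + k))%N) = r0 (N + n)%N.
  by elim: k => [|k IH]; rewrite ?addn0 // addnS iterSr rN.
pose j := `|M - height w o (r0 N)|%N.
have Mj : M <= height w o (r0 (N + j)%N).
  have := height_iter w treeP o (r0 (N + j)%N) j.
  by have := up 0%N j; rewrite add0n addn0 => ->; rewrite /j; lia.
exists [set r0 (N + j)%N]; first exact: finite_set1.
move=> x /(component_below _ _ _ _ w1r)[K /(_ (N + j + K)%N)].
move=> /(_ (leq_addl _ _)) [_ xb].
have [k kx] : below (r0 (N + j)%N) x.
  by apply: xb; exists K; rewrite -addnA up.
by have := height_iter w treeP o x k; rewrite kx; lia.
Qed.

Lemma end_component_antimono (F G : set V) :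
  F `<=` G -> end_component G w `<=` end_component F w.
Proof.
move=> FG x [r wr [m [s [rG sp sl sG]]]].
exists r => //; exists m, s; split=> //.
  by move=> n mn /FG; exact: rG.
by move=> y ys /FG; exact: sG.
Qed.

Lemma ray_leaves_finite (r : nat -> V) (F : set V) : injective r ->
  finite_set F -> exists m, forall n, (m <= n)%N -> ~ F (r n).
Proof.
move=> ri Ff.
have fin : finite_set (r @^-1` F).
  by apply: finite_preimage => // ? ? _ _ /ri.
have [s rFs] := (finite_seqP _).1 fin.
have [m ms] : exists m, forall n, n \in s -> (n < m)%N.
  elim: s {rFs} => [|i s [m ms]]; first by exists 0%N.
  exists (maxn i.+1 m) => n; rewrite inE => /orP[/eqP->|/ms]; lia.
exists m => n mn Frn; have /ms : n \in s; last by lia.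
by have : (r @^-1` F) n by []; rewrite rFs.
Qed.

(** Properness holds because a ray of [w] leaves every finite set; it makes the limit in [busemann]
    unique. *)
Lemma end_nbhs_filter : ProperFilter (end_nbhs w).
Proof.
split.
  move=> [F Ff] sub.
  have [r [re ri] wE] := end_raysP w.
  have [m rF] := ray_leaves_finite _ _ ri Ff.
  apply: (sub (r m)); exists r.
    by rewrite wE; split => //; exists 0%N, 0%N.
  by exists m, [::]; split => // y; rewrite inE => /eqP ->; exact: rF.
split.
- by exists set0.
- move=> A B [F Ff FA] [G Gf GB]; exists (F `|` G).
    by rewrite finite_setU.
  move=> x xFG; split.
    by apply: FA; apply: end_component_antimono xFG; exact: subsetUl.
  by apply: GB; apply: end_component_antimono xFG; exact: subsetUr.
- by move=> A B AB [F Ff FA]; exists F => //; exact: subset_trans AB.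
Qed.

(** The ray from [x] joins those from [y] and [o] only at or above [v], where these two have merged.
    Both meeting points therefore coincide and the difference is [a - b]. *)
Lemma gdist_not_below (o v x y : V) : below v o -> below v y -> ~ below v x ->
  (gdist e x y)%:Z - (gdist e x o)%:Z = height w o y.
Proof.
move=> [b ob] [a ya] nx.
have [m [n xy]] := meet_ex w treeP x y; have [k [l xo]] := meet_ex w treeP x o.
rewrite (gdist_meet _ treeP _ _ _ _ xy) (gdist_meet _ treeP _ _ _ _ xo).
have an : (a <= n)%N.
  rewrite leqNgt; apply/negP => na; apply: nx; exists (a - n + m)%N.
  by rewrite iterD xy.1 -iterD subnK // ltnW.
have bl : (b <= l)%N.
  rewrite leqNgt; apply/negP => lb; apply: nx; exists (b - l + k)%N.
  by rewrite iterD xo.1 -iterD subnK // ltnW.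
have E1 : iter m (parent w) x = iter (n - a + b)%N (parent w) o.
  by rewrite xy.1 iterD ob -ya -iterD subnK.
have E2 : iter k (parent w) x = iter (l - b + a)%N (parent w) y.
  by rewrite xo.1 iterD ya -ob -iterD subnK.
rewrite (heightE w treeP o y a b) ?ya ?ob //.
by have := xo.2 _ _ E1; have := xy.2 _ _ E2; lia.
Qed.

Lemma below_join (u v : V) : exists x, below x u /\ below x v.
Proof.
have [m [n [mn _]]] := meet_ex w treeP u v.
by exists (iter m (parent w) u); split; [exists m|exists n].
Qed.

Lemma busemannE (R : realType) (o y : V) :
  busemann R o w y = (height w o y)%:~R.
Proof.
have pf := end_nbhs_filter; have [v [vo vy]] := below_join o y.
rewrite /busemann; apply: cvg_lim => //; apply: cvg_near_cst.
apply: filterS (end_nbhs_not_below v) => x xv.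
rewrite -(gdist_not_below _ _ _ _ vo vy xv) !(gdist_sym w treeP x).
by rewrite intrB.
Qed.

(** The ray to [w] from a vertex lower than all of [F] only gets lower, so it avoids [F]. *)
Lemma low_height_component (o : V) (F : set V) : finite_set F ->
  exists M : int, forall x, height w o x < M -> end_component F w x.
Proof.
move=> /finite_seqP[s ->].
have [M sM] : exists M : int, forall y, y \in s -> M <= height w o y.
  elim: s => [|y s [M sM]]; first by exists 0.
  exists (Num.min (height w o y) M) => z.
  by rewrite inE => /orP[/eqP->|/sM]; lia.
exists M => x xM; exists (fun n => iter n (parent w) x); first exact: iter_ray.
have av n : iter n (parent w) x \notin s.
  by apply/negP => /sM; rewrite (height_iter w treeP); lia.
exists 0%N, [::]; split => // [n _|y].
  exact/negP/av.
by rewrite inE => /eqP ->; exact/negP/(av 0%N).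
Qed.

(* Leaving the set of descendants of every vertex: weaker than converging to
   [w], but enough to replace distance differences by heights. *)
Definition escapes (x : nat -> V) : Prop :=
  forall v, \forall n \near \oo, ~ below v (x n).

Lemma escapes_cvg (x : nat -> V) : x @ \oo --> end_nbhs w -> escapes x.
Proof. by move=> xw v; exact: (xw _ (end_nbhs_not_below v)). Qed.

(** A descendant of [v] of height at most [M] is a bounded number of steps below [v], hence at
    bounded distance from [o]. *)
Lemma escapes_bounded (o : V) (M : int) (x : nat -> V) :
  (forall n, height w o (x n) <= M) ->
  gdist e (x n) o @[n --> \oo] --> \oo -> escapes x.
Proof.
move=> xM /cvgnyPge xo v.
have [b [a ab]] := (meet_ex w treeP o v).
near=> n; move=> [k kx].
have : (`|(M - height w o v)| + b + a < gdist e (x n) o)%N.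
  by near: n; exact: xo.
have := gdist_le _ _ _ (walk_join w treeP (x n) o (a + k) b _).
rewrite iterD kx ab.1 => /(_ erefl).
have := height_iter w treeP o (x n) k; rewrite kx; have := xM n; lia.
Unshelve. all: by end_near. Qed.

Lemma escapes_gdist (o y : V) (x : nat -> V) : escapes x ->
  \forall n \near \oo,
    (gdist e (x n) y)%:Z - (gdist e (x n) o)%:Z = height w o y.
Proof.
move=> xe; have [v [vo vy]] := below_join o y.
by apply: filterS (xe v) => n; exact: gdist_not_below.
Qed.

Lemma cvg_low_height (o : V) (x : nat -> V) :
  (forall M : int, \forall n \near \oo, height w o (x n) <= M) ->
  x @ \oo --> end_nbhs w.
Proof.
move=> xlow A [F Ff FA]; have [M FM] := low_height_component o _ Ff.
by apply: filterS (xlow (M - 1)) => n nM; apply/FA/FM; lia.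
Qed.

End EndLimits.

(** A childless vertex would have its parent as only neighbour, against degree at least two. *)
Lemma child_ex {V : choiceType} {e : rel V} (w : tree_end e) (k : nat) (u : V) :
  regular_tree e k.+2 -> exists v, parent w v = u.
Proof.
move=> [treeP /(_ u) deg]; apply: contrapT => /forallNP nochild.
have sub : [set v | e u v] `<=` [set parent w u].
  by move=> v /(edge_parent w treeP)[//|/esym/nochild].
have := subset_card_le sub.
by rewrite (card_le_eql deg) (card_le_eqr card_set1) card_le_II.
Qed.

(** * The distance formula in the Diestel-Leader graph *)

Section DLDistance.
Context {T T' : choiceType} {e : rel T} {e' : rel T'}.
Context (treeP : is_tree e) (treeP' : is_tree e').
Context (w0 : tree_end e) (o : T) (w0' : tree_end e') (o' : T').
Local Notation adj := (@DL_adj _ _ _ _ w0 o w0' o').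
Local Notation DL := (DL_vertex w0 o w0' o').
Local Notation h := (height w0 o).
Local Notation h' := (height w0' o').

Lemma DL_height (x : DL) : h' (DL_snd x) = - h (DL_fst x).
Proof. by have /eqP := valP x; rewrite /DL_fst /DL_snd /=; lia. Qed.

Lemma DL_mk (u : T) (u' : T') : h u + h' u' = 0 ->
  exists x : DL, DL_fst x = u /\ DL_snd x = u'.
Proof. by move=> /eqP uu'; exists (exist _ (u, u') uu'). Qed.

Lemma DL_eq (x y : DL) : DL_fst x = DL_fst y -> DL_snd x = DL_snd y -> x = y.
Proof.
case: x y => [[u u'] xP] [[v v'] yP]; rewrite /DL_fst /DL_snd /= => uv uv'.
by apply: val_inj; rewrite /= uv uv'.
Qed.

Lemma DL_adj_sym : symmetric adj.
Proof.
have [esym _ _ _] := treeP; have [esym' _ _ _] := treeP'.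
by move=> x y; rewrite /DL_adj esym esym'.
Qed.

Lemma DL_climb (x y : DL) (m : nat) :
  DL_fst y = iter m (parent w0) (DL_fst x) ->
  DL_snd x = iter m (parent w0') (DL_snd y) -> walk_length adj x y m.
Proof.
elim: m x => [|m IH] x fy sx; first by apply/walk0/DL_eq; rewrite ?fy ?sx.
have [|z [fz sz]] :=
  DL_mk (parent w0 (DL_fst x)) (iter m (parent w0') (DL_snd y)).
  rewrite (height_parent w0 treeP) (height_iter w0' treeP') DL_height fy.
  by rewrite (height_iter w0 treeP); lia.
apply: (walk_step _ z); last by apply: IH => //; rewrite fz -iterSr.
rewrite /DL_adj fz sz sx; apply/andP; split.
  by apply/(edge_parent w0 treeP); left.
by apply/(edge_parent w0' treeP'); right.
Qed.

(** The truncated differences add up to [|m - n|], the absolute height difference. Induction on the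
    walk: the heights force each edge to go up in one tree and down in the other. *)
Lemma DL_walk_lower (x y : DL) (N m n m' n' : nat) :
  walk_length adj x y N ->
  meet w0 (DL_fst x) (DL_fst y) m n -> meet w0' (DL_snd x) (DL_snd y) m' n' ->
  (m + n + m' + n' <= N + (m - n) + (n - m))%N.
Proof.
elim: N x m n m' n' => [|N IH] x m n m' n'.
  move=> /walk0-> [_ /(_ 0%N 0%N erefl)] [m0 n0] [_ /(_ 0%N 0%N erefl)].
  by move: m0 n0; lia.
move=> /walk_inv[z xz zy] mn mn'.
have [a [b ab]] := meet_ex w0 treeP (DL_fst z) (DL_fst y).
have [a' [b' ab']] := meet_ex w0' treeP' (DL_snd z) (DL_snd y).
have := IH _ _ _ _ _ zy ab ab'.
have hxz := DL_height x; have hz := DL_height z; have hy := DL_height y.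
have j1 := height_join w0 treeP o _ _ _ _ mn.1.
have j1' := height_join w0' treeP' o' _ _ _ _ mn'.1.
have j2 := height_join w0 treeP o _ _ _ _ ab.1.
have j2' := height_join w0' treeP' o' _ _ _ _ ab'.1.
have up (V : choiceType) (f : rel V) (w : tree_end f) u v s k l i j :
    s = parent w u -> meet w u v k l -> meet w s v i j ->
    (k <= i.+1 /\ l <= j)%N.
  by move=> su [_ min] [ij _]; apply: min; rewrite iterSr -su.
(* If [i = 0], then [s] is an ancestor of [v], and its parent [u] is one step further from [v]; this
   is the correction term. *)
have down (V : choiceType) (f : rel V) (w : tree_end f) u v s k l i j :
    u = parent w s -> meet w u v k l -> meet w s v i j ->
    (k <= i.-1 /\ l <= j + (i == 0))%N.
  move=> us [_ min] [ij _]; apply: min; rewrite us.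
  by case: i ij => [|i] /=; rewrite ?addn0 ?addn1 -?iterSr //= => ->.
move: xz => /andP[/(edge_parent w0 treeP)exz /(edge_parent w0' treeP')exz'].
case: exz exz' => [xz|zx] [xz'|zx'].
- have := height_parent w0 treeP o (DL_fst x).
  by have := height_parent w0' treeP' o' (DL_snd x); rewrite -xz -xz'; lia.
- have := up _ _ _ _ _ _ _ _ _ _ xz mn ab.
  have := down _ _ _ _ _ _ _ _ _ _ zx' mn' ab'.
  have := height_parent w0 treeP o (DL_fst x); rewrite -xz.
  by case: a' j2' {ab'} => [|a'] /=; lia.
- have := down _ _ _ _ _ _ _ _ _ _ zx mn ab.
  have := up _ _ _ _ _ _ _ _ _ _ xz' mn' ab'.
  have := height_parent w0 treeP o (DL_fst z); rewrite -zx.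
  by case: a j2 {ab} => [|a] /=; lia.
- have := height_parent w0 treeP o (DL_fst z).
  by have := height_parent w0' treeP' o' (DL_snd z); rewrite -zx -zx'; lia.
Qed.

Context (childP : forall u, exists v, parent w0 v = u).
Context (childP' : forall u, exists v, parent w0' v = u).

Lemma iter_child {V : choiceType} (f : V -> V) (m : nat) (u : V) :
  (forall u, exists v, f v = u) -> exists v, iter m f v = u.
Proof.
move=> fP; elim: m u => [|m IH] u; first by exists u.
by have [v <-] := fP u; have [x <-] := IH v; exists x.
Qed.

(** Four legs: in [T] climb [m], descend [n] to [y], dip [n'] down to [c] and return; in [T']
    descend [m] to [c'], climb [n], climb [n'] to the meeting point, descend [n'] to [y]. *)
Lemma DL_walk_upper (x y : DL) (m n m' n' : nat) :
  iter m (parent w0) (DL_fst x) = iter n (parent w0) (DL_fst y) ->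
  iter m' (parent w0') (DL_snd x) = iter n' (parent w0') (DL_snd y) ->
  (m <= n)%N -> walk_length adj x y (m + n + n' + n').
Proof.
move=> mn mn' m_n.
have hx := DL_height x; have hy := DL_height y.
have j := height_join w0 treeP o _ _ _ _ mn.
have j' := height_join w0' treeP' o' _ _ _ _ mn'.
have [c' c'x] := iter_child (parent w0') m (DL_snd x) childP'.
have [c cy] := iter_child (parent w0) n' (DL_fst y) childP.
have hc' := height_iter w0' treeP' o' c' m; rewrite c'x in hc'.
have hc := height_iter w0 treeP o c n'; rewrite cy in hc.
have ha := height_iter w0 treeP o (DL_fst x) m.
have ha' := height_iter w0' treeP' o' (DL_snd x) m'.
have [|z1 [f1 s1]] := DL_mk (iter m (parent w0) (DL_fst x)) c'; first by lia.
have [|z2 [f2 s2]] := DL_mk (DL_fst y) (iter n (parent w0') c').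
  by rewrite (height_iter w0' treeP'); lia.
have [|z3 [f3 s3]] := DL_mk c (iter m' (parent w0') (DL_snd x)); first by lia.
apply: (walk_cat _ z3); last first.
  by apply: DL_climb; rewrite ?f3 ?s3 ?cy.
apply: (walk_cat _ z2); last first.
  apply: walk_sym DL_adj_sym _; apply: DL_climb; rewrite ?f2 ?f3 ?cy //.
  rewrite s2 s3 -c'x -!iterD; congr iter; lia.
apply: (walk_cat _ z1); first by apply: DL_climb; rewrite ?f1 ?s1 ?c'x.
by apply: walk_sym DL_adj_sym _; apply: DL_climb; rewrite ?f1 ?f2 ?s1 ?s2 ?mn.
Qed.

Lemma DL_gdist (x y : DL) : (gdist adj x y)%:Z =
  (gdist e (DL_fst x) (DL_fst y))%:Z + (gdist e' (DL_snd x) (DL_snd y))%:Z -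
  `|h (DL_fst x) - h (DL_fst y)|.
Proof.
have [m [n mn]] := meet_ex w0 treeP (DL_fst x) (DL_fst y).
have [m' [n' mn']] := meet_ex w0' treeP' (DL_snd x) (DL_snd y).
rewrite (gdist_meet w0 treeP _ _ _ _ mn) (gdist_meet w0' treeP' _ _ _ _ mn').
have j := height_join w0 treeP o _ _ _ _ mn.1.
have j' := height_join w0' treeP' o' _ _ _ _ mn'.1.
have hx := DL_height x; have hy := DL_height y.
(* Heights give [m + m' = n + n'], so the minimum is [m + n + m' + n' - |m - n|]; the case [n < m]
   uses the reversed walk. *)
rewrite (gdist_eq _ _ (minn (m + n + n' + n') (m + n + m' + m'))); first by lia.
  have [m_n|n_m] := leqP m n.
    rewrite (_ : minn _ _ = m + n + n' + n')%N; last by lia.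
    exact: DL_walk_upper mn.1 mn'.1 m_n.
  rewrite (_ : minn _ _ = n + m + m' + m')%N; last by lia.
  apply: walk_sym DL_adj_sym _.
  by apply: DL_walk_upper; rewrite ?mn.1 ?mn'.1 // ltnW.
by move=> N /DL_walk_lower - /(_ _ _ _ _ mn mn'); lia.
Qed.

End DLDistance.

(** * Eventual values of the distance differences *)

Section DistanceDifference.
Context {T T' : choiceType} {e : rel T} {e' : rel T'}.
Context (treeP : is_tree e) (treeP' : is_tree e').
Context (w0 : tree_end e) (o : T) (w0' : tree_end e') (o' : T').
Context (x : nat -> T) (x' : nat -> T').
Local Notation h := (height w0 o).
Local Notation h' := (height w0' o').
(** Near an end other than [w0] heights in [T] are large, so those in [T'] tend to minus infinity,
    which forces convergence to [w0']. *)
Lemma cvg_other_end (w : tree_end e) :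
  (forall n, h' (x' n) = - h (x n)) -> w <> w0 ->
  x @ \oo --> end_nbhs w ->
  (forall M : int, \forall n \near \oo, M <= h (x n)) /\
  x' @ \oo --> end_nbhs w0'.
Proof.
move=> hx ww0 xw.
have xM M : \forall n \near \oo, M <= h (x n).
  exact: (xw _ (end_nbhs_height treeP w0 o w M ww0)).
split => //; apply: (cvg_low_height treeP' w0' o') => M.
by apply: filterS (xM (- M)) => n; rewrite hx; lia.
Qed.

Context (y : T) (y' : T') (hy : h' y' = - h y).

(* By [DL_gdist], the difference of the distances in DL(p,q) from
   [(x n, x' n)] to [(y, y')] and to [(o, o')]. *)
Let diff (n : nat) : int :=
  (gdist e (x n) y)%:Z + (gdist e' (x' n) y')%:Z - `|h (x n) - h y|
  - ((gdist e (x n) o)%:Z + (gdist e' (x' n) o')%:Z - `|h (x n) - h o|).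

(** Once [h (x n)] exceeds [h y] and 0, the absolute values contribute [h y], which cancels the
    contribution [h' y' = - h y] of [T']. *)
Lemma diff_end (w : tree_end e) : escapes w x -> escapes w0' x' ->
  (forall M : int, \forall n \near \oo, M <= h (x n)) ->
  \forall n \near \oo, diff n = height w o y - height w o o.
Proof.
move=> xw xw' xM; near=> n.
have : (gdist e (x n) y)%:Z - (gdist e (x n) o)%:Z = height w o y.
  by near: n; exact: escapes_gdist.
have : (gdist e' (x' n) y')%:Z - (gdist e' (x' n) o')%:Z = h' y'.
  by near: n; exact: escapes_gdist.
have : h y <= h (x n) by near: n; exact: xM.
have : 0 <= h (x n) by near: n; exact: xM.
rewrite /diff !height_base // hy; lia.
Unshelve. all: by end_near. Qed.

(** [gdist_confluent] expands the distances in [T]; the resulting [h y] cancels against [h' y'] from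
    [T']. *)
Lemma diff_vertex (x0 : T) : (forall n, x n = x0) -> escapes w0' x' ->
  \forall n \near \oo, diff n =
    (- 2 * h (confluent w0 y x0) - `|h y - h x0|) -
    (- 2 * h (confluent w0 o x0) - `|h o - h x0|).
Proof.
move=> xx0 xw'; near=> n.
have : (gdist e' (x' n) y')%:Z - (gdist e' (x' n) o')%:Z = h' y'.
  by near: n; exact: escapes_gdist.
rewrite /diff xx0 !(gdist_sym w0 treeP x0) !(gdist_confluent w0 treeP o).
rewrite (height_base w0 treeP) hy; lia.
Unshelve. all: by end_near. Qed.

(** The contributions [h y] and [h' y'] of the two trees cancel, leaving the absolute values. *)
Lemma diff_level (i : int) : (forall n, h (x n) = i) ->
  escapes w0 x -> escapes w0' x' ->
  \forall n \near \oo, diff n = (- `|h y - i|) - (- `|h o - i|).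
Proof.
move=> xi xw xw'; near=> n.
have : (gdist e (x n) y)%:Z - (gdist e (x n) o)%:Z = h y.
  by near: n; exact: escapes_gdist.
have : (gdist e' (x' n) y')%:Z - (gdist e' (x' n) o')%:Z = h' y'.
  by near: n; exact: escapes_gdist.
rewrite /diff xi hy; lia.
Unshelve. all: by end_near. Qed.

End DistanceDifference.

(** * From eventually constant integer differences to the limits in the horocompactification *)

Lemma horo_cvg_int {T T' : choiceType} {e : rel T} {e' : rel T'}
    {w0 : tree_end e} {o : T} {w0' : tree_end e'} {o' : T'} (R : realType)
    (z : nat -> DL_vertex w0 o w0' o') (f : DL_vertex w0 o w0' o' -> R)
    (g : DL_vertex w0 o w0' o' -> int) :
  (forall y, f y = (g y)%:~R) ->
  (forall y, \forall n \near \oo,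
     (gdist (@DL_adj _ _ _ _ w0 o w0' o') (z n) y)%:Z -
     (gdist (@DL_adj _ _ _ _ w0 o w0' o') (z n) (DL_base w0 o w0' o'))%:Z =
     g y - g (DL_base w0 o w0' o')) ->
  horo_cvg z f.
Proof.
move=> fg zg y; apply: cvg_near_cst; apply: filterS (zg y) => n.
by rewrite !fg -intrB => <-; rewrite intrB.
Qed.

Lemma cvgr_int {R : realType} (a : nat -> int) :
  ((a n)%:~R : R) @[n --> \oo] --> +oo ->
  forall M : int, \forall n \near \oo, M <= a n.
Proof.
by move=> /cvgryPge aoo M; apply: filterS (aoo M%:~R) => n; rewrite ler_int.
Qed.

Theorem proposition6p4 (R : realType) (p q : nat)
    (hp : (2 <= p)%N) (hq : (2 <= q)%N)
    (T T' : choiceType) (e : rel T) (e' : rel T')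
    (hT : regular_tree e p.+1) (hT' : regular_tree e' q.+1)
    (o : T) (o' : T') (w0 : tree_end e) (w0' : tree_end e')
    (z : nat -> DL_vertex w0 o w0' o') :
  let x := fun n => DL_fst (z n) in
  let x' := fun n => DL_snd (z n) in
  let h := height w0 o in
  let h' := height w0' o' in
  (forall w : tree_end e, w <> w0 ->
     x @ \oo --> end_nbhs w ->
     x' @ \oo --> end_nbhs w0' /\ horo_cvg z (rho_end R w)) /\
  (forall w' : tree_end e', w' <> w0' ->
     x' @ \oo --> end_nbhs w' ->
     x @ \oo --> end_nbhs w0 /\ horo_cvg z (rho_end' R w')) /\
  (x @ \oo --> end_nbhs w0 -> x' @ \oo --> end_nbhs w0' ->
     ((h (x n))%:~R : R) @[n --> \oo] --> +oo ->
     horo_cvg z (rho_end R w0)) /\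
  (x @ \oo --> end_nbhs w0 -> x' @ \oo --> end_nbhs w0' ->
     ((h' (x' n))%:~R : R) @[n --> \oo] --> +oo ->
     horo_cvg z (rho_end' R w0')) /\
  (forall x0 : T, (forall n, x n = x0) ->
     gdist e' (x' n) o' @[n --> \oo] --> \oo ->
     (forall n, h' (x' n) = - h x0) /\ horo_cvg z (rho_vertex R x0)) /\
  (forall x0' : T', (forall n, x' n = x0') ->
     gdist e (x n) o @[n --> \oo] --> \oo ->
     (forall n, h (x n) = - h' x0') /\ horo_cvg z (rho_vertex' R x0')) /\
  (forall i : int,
     gdist e (x n) o @[n --> \oo] --> \oo ->
     gdist e' (x' n) o' @[n --> \oo] --> \oo ->
     (forall n, h (x n) = - h' (x' n) /\ - h' (x' n) = i) ->
     horo_cvg z (rho_level R i)).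
Proof.
move=> x x' h h'.
(* Replacing [p] and [q] by successors puts the degrees in the form [k.+2] of [child_ex]. *)
case: p hp hT => [|p] // _ hT; case: q hq hT' => [|q] // _ hT'.
have treeP := hT.1; have treeP' := hT'.1.
have dist := DL_gdist treeP treeP' w0 o w0' o'
  (fun u => child_ex w0 p u hT) (fun u => child_ex w0' q u hT').
(* The distance formula with the trees exchanged, so that the primed cases reuse the same lemmas. *)
have dist' (a b : DL_vertex w0 o w0' o') :
    (gdist (@DL_adj _ _ _ _ w0 o w0' o') a b)%:Z =
    (gdist e' (DL_snd a) (DL_snd b))%:Z + (gdist e (DL_fst a) (DL_fst b))%:Z -
    `|h' (DL_snd a) - h' (DL_snd b)|.
  by rewrite dist /h' !DL_height; lia.
have hz (a : DL_vertex w0 o w0' o') : h' (DL_snd a) = - h (DL_fst a).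
  exact: DL_height.
have hz' (a : DL_vertex w0 o w0' o') : h (DL_fst a) = - h' (DL_snd a).
  by rewrite hz opprK.
(* Serves both [w <> w0] and [w = w0]. *)
have zcvg (w : tree_end e) : escapes w x -> escapes w0' x' ->
    (forall M : int, \forall n \near \oo, M <= h (x n)) ->
    horo_cvg z (rho_end R w).
  move=> xw xw' xM.
  apply: (horo_cvg_int _ _ _ (fun y => height w o (DL_fst y))).
    by move=> y; rewrite /rho_end busemannE.
  move=> y.
  have := diff_end treeP treeP' w0 o w0' o' x x' _ _ (hz y) w
    xw xw' xM.
  by apply: filterS => n; rewrite !dist.
have zcvg' (w' : tree_end e') : escapes w0 x -> escapes w' x' ->
    (forall M : int, \forall n \near \oo, M <= h' (x' n)) ->
    horo_cvg z (rho_end' R w').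
  move=> xw xw' xM.
  apply: (horo_cvg_int _ _ _ (fun y => height w' o' (DL_snd y))).
    by move=> y; rewrite /rho_end' busemannE.
  move=> y.
  have := diff_end treeP' treeP w0' o' w0 o x' x _ _ (hz' y) w'
    xw' xw xM.
  by apply: filterS => n; rewrite !dist'.
split; [|split; [|split; [|split; [|split; [|split]]]]].
- move=> w ww0 xw.
  have [xM xw'] := cvg_other_end treeP treeP' w0 o w0' o' x x' w
    (fun n => hz (z n)) ww0 xw.
  by split=> //; apply: zcvg => //; exact: escapes_cvg.
- move=> w ww0 xw'.
  have [xM xw] := cvg_other_end treeP' treeP w0' o' w0 o x' x w
    (fun n => hz' (z n)) ww0 xw'.
  by split=> //; apply: zcvg' => //; exact: escapes_cvg.
- by move=> xw xw' /cvgr_int xM; apply: zcvg => //; exact: escapes_cvg.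
- by move=> xw xw' /cvgr_int xM; apply: zcvg' => //; exact: escapes_cvg.
- move=> x0 xx0 xoo.
  have hx0 n : h' (x' n) = - h x0 by rewrite -(xx0 n); exact: hz.
  (* The height of [x' n] is constant, so its distance from [o'] can only grow by escaping. *)
  have xw' : escapes w0' x'.
    apply: (escapes_bounded treeP' w0' o' (- h x0)) => // n.
    by rewrite -(hx0 n).
  split=> //; apply: horo_cvg_int => [y|y]; first by [].
  have := diff_vertex treeP treeP' w0 o w0' o' x x' _ _ (hz y) x0 xx0 xw'.
  by apply: filterS => n; rewrite !dist.
- move=> x0' xx0' xoo.
  have hx0 n : h (x n) = - h' x0' by rewrite -(xx0' n); exact: hz'.
  have xw : escapes w0 x.
    by apply: (escapes_bounded treeP w0 o (- h' x0')) => // n; rewrite -(hx0 n).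
  split=> //; apply: horo_cvg_int => [y|y]; first by [].
  have := diff_vertex treeP' treeP w0' o' w0 o x' x _ _ (hz' y) x0' xx0' xw.
  by apply: filterS => n; rewrite !dist'.
move=> i xoo xoo' xi.
have hxi n : h (x n) = i by have [-> ->] := xi n.
have hxi' n : h' (x' n) = - i by have [_ <-] := xi n; rewrite opprK.
have xw : escapes w0 x.
  by apply: (escapes_bounded treeP w0 o i) => // n; rewrite -(hxi n).
have xw' : escapes w0' x'.
  by apply: (escapes_bounded treeP' w0' o' (- i)) => // n; rewrite -(hxi' n).
apply: horo_cvg_int => [y|y]; first by [].
have := diff_level treeP treeP' w0 o w0' o' x x' _ _ (hz y) i hxi xw xw'.
by apply: filterS => n; rewrite !dist.
Qed.
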